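(* Let $A\in\mathbb{M}_n(\mathbb{C})$ with $\mathrm{ind}(A)=k$ and let $A_1=AA^DA$ be the core part of $A$. Then the following statements are equivalent: (i) $A$ is CEPD, i.e. $A^{\mathrm{cep}}A^D=A^DA^{\mathrm{cep}}$; (ii) $A_1A^{\mathrm{cep}}=A^{\mathrm{cep}}A_1$; (iii) $A^DA^{k+1}(A^k)^\dagger=A^{k+1}(A^k)^\dagger A^D$; (iv) $A_1A^{k+1}(A^k)^\dagger=A^{k+1}(A^k)^\dagger A_1$; (v) $A^{k+2}(A^k)^\dagger=AA_1$; (vi) $A^{\mathrm{cep}}=A^D$; (vii) $(A^{\mathrm{cep}})^m=(A^D)^m$ for any (every) positive integer $m\ge 2$; (viii) $(A^{\mathrm{cep}})^m=(A^D)^m$ for some positive integer $m\ge 2$.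
   Context: $\mathbb{M}_n(\mathbb{C})$ is the algebra of $n\times n$ complex matrices; $^*$ is conjugate transpose; $\mathcal{R}(\cdot)$ is column space; $A^0=I$. The index $\mathrm{ind}(A)$ is the smallest integer $k\ge 0$ with $\mathrm{rank}(A^k)=\mathrm{rank}(A^{k+1})$. $A^\dagger$ is the Moore-Penrose inverse. With $k=\mathrm{ind}(A)$, the Drazin inverse $A^D$ is the unique $X$ with $AX=XA$, $XAX=X$, $XA^{k+1}=A^k$. The core EP inverse of $A$, denoted here $A^{\mathrm{cep}}$, is the unique $X\in\mathbb{M}_n(\mathbb{C})$ with $XAX=X$ and $\mathcal{R}(X)=\mathcal{R}(A^k)=\mathcal{R}(X^* )$. $A$ is called core EP Drazin (CEPD) if $A^{\mathrm{cep}}A^D=A^DA^{\mathrm{cep}}$. *)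

(* Defs.v *)
From mathcomp Require Import all_boot all_order all_algebra.

Set Implicit Arguments.
Unset Strict Implicit.
Unset Printing Implicit Defensive.

Import Order.TTheory GRing.Theory Num.Theory.
Local Open Scope ring_scope.
Local Open Scope sesquilinear_scope.

Section ColumnSpace.
Variable F : fieldType.

(* MathComp compares row spaces, whence the transposes. *)
Definition same_colspace m n p (A : 'M[F]_(m, n)) (B : 'M[F]_(m, p)) : bool :=
  (A^T == B^T)%MS.

Lemma same_colspaceP m n p (A : 'M[F]_(m, n)) (B : 'M[F]_(m, p)) :
  reflect ((exists U, A = B *m U) /\ (exists V, B = A *m V))
          (same_colspace A B).
Proof.
have subP q r (M : 'M[F]_(m, q)) (N : 'M[F]_(m, r)) :
    reflect (exists U, M = N *m U) (M^T <= N^T)%MS.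
  apply: (iffP submxP) => -[U dU]; exists U^T.
    by apply: trmx_inj; rewrite trmx_mul trmxK.
  by rewrite dU trmx_mul.
apply: (iffP andP) => -[h1 h2]; split.
- exact: (elimT (subP _ _ A B)).
- exact: (elimT (subP _ _ B A)).
- exact: (introT (subP _ _ A B)).
- exact: (introT (subP _ _ B A)).
Qed.

End ColumnSpace.

Section Index.
Variables (F : fieldType) (n : nat).
Implicit Types A : 'M[F]_n.

Lemma mxindex_ex A : exists k, \rank (A ^+ k) == \rank (A ^+ k.+1).
Proof.
pose stable k := \rank (A ^+ k) == \rank (A ^+ k.+1).
have [/existsP[k hk]|/existsPn hn] := boolP [exists k : 'I_n.+1, stable k].
  by exists k.
have le k : (k <= n.+1)%N -> (\rank (A ^+ k) + k <= n)%N.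
  elim: k => [|k IHk] hk; first by rewrite addn0 rank_leq_row.
  have hr : (\rank (A ^+ k.+1) <= \rank (A ^+ k))%N.
    by rewrite exprS; apply: mxrankM_maxr.
  apply: leq_trans (IHk (ltnW hk)); rewrite addnS -addSn leq_add2r.
  by rewrite ltn_neqAle hr andbT eq_sym; apply: (hn (Ordinal hk)).
by have := le n.+1 (leqnn _); rewrite addnS ltnNge leq_addl.
Qed.

Definition mxindex A : nat := ex_minn (mxindex_ex A).

Lemma mxindexP A : \rank (A ^+ mxindex A) = \rank (A ^+ (mxindex A).+1).
Proof. by rewrite /mxindex; case: ex_minnP => k /eqP. Qed.

Lemma mxindex_min A k :
  \rank (A ^+ k) = \rank (A ^+ k.+1) -> (mxindex A <= k)%N.
Proof. by rewrite /mxindex; case: ex_minnP => m _ + /eqP; apply. Qed.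

Lemma powerD A i j : A ^+ (i + j) = A ^+ i *m A ^+ j.
Proof. exact: exprD. Qed.

Lemma trmx_power A k : (A ^+ k)^T = A^T ^+ k.
Proof.
elim: k => [|k IHk]; first by rewrite !expr0 trmx1.
by rewrite exprS exprSr trmx_mul IHk.
Qed.

Lemma rank_stable_row A k : \rank (A ^+ k) = \rank (A ^+ k.+1) ->
  forall j, exists W, A ^+ k = W *m A ^+ (k + j).
Proof.
move=> rk; have [W1 dW]: exists W, A ^+ k = W *m A ^+ k.+1.
  have leA : (A ^+ k.+1 <= A ^+ k)%MS by rewrite exprS submxMl.
  by apply/submxP; have := mxrank_leqif_sup leA; case=> _ <-; apply/eqP.
elim=> [|j [W dWj]]; first by exists 1%:M; rewrite addn0 mul1mx.
exists (W *m W1).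
by rewrite {1}dWj powerD {1}dW -addSnnS powerD !mulmxA.
Qed.

Lemma rank_stable_col A k : \rank (A ^+ k) = \rank (A ^+ k.+1) ->
  forall j, exists V, A ^+ k = A ^+ (k + j) *m V.
Proof.
move=> rk j; have [|W dW] := @rank_stable_row A^T k _ j.
  by rewrite -!trmx_power !mxrank_tr.
by exists W^T; apply: trmx_inj; rewrite trmx_mul trmxK !trmx_power.
Qed.

End Index.

Section Drazin.
Variables (F : fieldType) (n : nat).
Implicit Types A X Y : 'M[F]_n.

Definition is_drazin A X : bool :=
  let k := mxindex A in
  [&& A *m X == X *m A, X *m A *m X == X & X *m A ^+ k.+1 == A ^+ k].

Lemma drazin_ex A : exists X, is_drazin A X.
Proof.
rewrite /is_drazin.
have AkS : A ^+ (mxindex A).+1 = A *m A ^+ mxindex A by exact: exprS.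
have AkSr : A ^+ (mxindex A).+1 = A ^+ mxindex A *m A by exact: exprSr.
have [W dW] := rank_stable_row (mxindexP A) (mxindex A).+1.
have [V dV] := rank_stable_col (mxindexP A) (mxindex A).+1.
move: dW dV; rewrite powerD AkS; move: AkSr; rewrite AkS => {AkS}.
move: (A ^+ _) => P AP; rewrite mulmxA => dW dV.
have [G BGB] : exists G, P *m A *m P *m G *m (P *m A *m P) = P *m A *m P.
  by exists (pinvmx (P *m A *m P)); apply: mulmxKpV.
rewrite !mulmxA in dW dV BGB.
have PGB : P *m G *m P *m A *m P = P.
  rewrite [X in X *m G]dW; have := congr1 (mulmx W) BGB.
  by rewrite !mulmxA -dW.
have BGP : P *m A *m P *m G *m P = P by rewrite [X in _ *m X]dV !mulmxA BGB -dV.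
exists (P *m G *m P); apply/and3P; split; apply/eqP; last first.
- by rewrite !mulmxA PGB.
- by rewrite !mulmxA PGB.
have -> : A *m (P *m G *m P) = P *m A *m V.
  rewrite -AP [X in A *m (_ *m X)]dV; have := congr1 (mulmx A) PGB.
  by rewrite !mulmxA => ->.
have -> : P *m G *m P *m A = W *m P *m A.
  rewrite [X in X *m G]dW; have := congr1 (mulmx W) BGP.
  by rewrite !mulmxA => ->.
have PAV : P *m A *m P *m A *m V = P *m A.
  rewrite -(mulmxA _ P A) -AP !mulmxA.
  by have := congr1 (mulmx A) dV; rewrite !mulmxA => <-.
by rewrite [X in X *m A *m V]dW -[in RHS]mulmxA -PAV !mulmxA.
Qed.

Definition drazin A : 'M[F]_n := xchoose (drazin_ex A).

Lemma drazinP A : is_drazin A (drazin A).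
Proof. exact: xchooseP. Qed.

Lemma drazin_uniq A X : is_drazin A X -> X = drazin A.
Proof.
have aux Y : is_drazin A Y -> [/\ A *m Y = Y *m A, Y *m A *m Y = Y,
      A *m Y *m A ^+ mxindex A = A ^+ mxindex A
      /\ A ^+ mxindex A *m (A *m Y) = A ^+ mxindex A,
      exists Z, A *m Y = Z *m A ^+ mxindex A
    & exists Z, A *m Y = A ^+ mxindex A *m Z].
  case/and3P => /eqP AY /eqP YAY /eqP YAk.
  have YE j : Y = Y ^+ j.+1 *m A ^+ j.
    elim: j => [|j IHj]; first by rewrite expr0 mulmx1.
    have -> : A ^+ j.+1 = A ^+ j *m A by exact: exprSr.
    have -> : Y ^+ j.+2 = Y *m Y ^+ j.+1 by exact: exprS.
    by rewrite mulmxA -(mulmxA Y) -IHj -mulmxA -AY mulmxA YAY.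
  have AYE : A *m Y = Y ^+ (mxindex A).+1 *m A *m A ^+ mxindex A.
    rewrite AY {1}(YE (mxindex A)) -!mulmxA; congr mulmx.
    by rewrite -[LHS]/(_ * _) -exprSr exprS.
  have AYAk : A *m Y *m A ^+ mxindex A = A ^+ mxindex A.
    by rewrite AY -mulmxA -[in RHS]YAk; congr mulmx; rewrite exprS.
  split=> //.
  - split=> //; rewrite -{2}AYAk.
    by apply/commr_sym/commrX/commr_sym/commrM.
  - by eexists; exact: AYE.
  - exists (Y ^+ (mxindex A).+1 *m A); rewrite AYE.
    apply/esym/commrM; apply/commr_sym/commrX => //.
    by apply: commr_sym; apply: commrX.
move=> /aux[AX XAX [XAk _] [Z dZ] _].
have /aux[] := drazinP A; move: (drazin A) => Y AY YAY [_ AkY] _ [Z' dZ'].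
have eXY : A *m X = A *m Y.
  have <- : A *m X *m (A *m Y) = A *m X by rewrite dZ -mulmxA AkY.
  by rewrite dZ' mulmxA XAk.
by rewrite -XAX -AX eXY AY -mulmxA eXY mulmxA YAY.
Qed.

Definition core_part A : 'M[F]_n := A *m drazin A *m A.

End Drazin.

Section MoorePenrose.
Variable C : numClosedFieldType.

Lemma adjmxM m n p (A : 'M[C]_(m, n)) (B : 'M[C]_(n, p)) :
  (A *m B)^t* = B^t* *m A^t*.
Proof. by rewrite trmx_mul map_mxM. Qed.

Lemma adjmx_mul_eq0 m n (A : 'M[C]_(m, n)) : A^t* *m A = 0 -> A = 0.
Proof.
move=> A0; apply/matrixP => i j; have /matrixP/(_ j j) := A0.
rewrite !mxE => /psumr_eq0P s0.
have := s0 _ i isT; rewrite !mxE => h; apply/eqP.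
rewrite -normr_eq0 -sqrf_eq0 normCK mulrC h // => k _.
by rewrite !mxE mulrC -normCK exprn_ge0.
Qed.

Lemma adjmx_cancel m n p (A : 'M[C]_(m, n)) (M N : 'M[C]_(n, p)) :
  A^t* *m A *m M = A^t* *m A *m N -> A *m M = A *m N.
Proof.
move=> eMN; apply/eqP; rewrite -subr_eq0 -mulmxBr; apply/eqP/adjmx_mul_eq0.
by rewrite adjmxM -mulmxA (mulmxA _ A) [X in _ *m X]mulmxBr eMN subrr mulmx0.
Qed.

(* The Moore-Penrose inverse; not to be confused with MathComp's [pinvmx],
   which only satisfies the first of the four Penrose equations. *)
Definition is_pinv m n (A : 'M[C]_(m, n)) (X : 'M[C]_(n, m)) : bool :=
  [&& A *m X *m A == A, X *m A *m X == X,
      (A *m X)^t* == A *m X & (X *m A)^t* == X *m A].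

Lemma inv13_ex m n (A : 'M[C]_(m, n)) :
  exists2 Z, A *m Z *m A = A & (A *m Z)^t* = A *m Z.
Proof.
have [G BGB] : exists G, A^t* *m A *m G *m (A^t* *m A) = A^t* *m A.
  by exists (pinvmx (A^t* *m A)); apply: mulmxKpV.
pose Z := G *m A^t*; have AZA : A *m Z *m A = A.
  rewrite -[RHS]mulmx1 -mulmxA; apply: adjmx_cancel.
  by rewrite mulmx1 /Z -[RHS]BGB !mulmxA.
have AAZ : A^t* *m A *m Z = A^t*.
  suff h : A *m (G^t* *m (A^t* *m A)) = A *m 1%:M.
    have := congr1 (fun M => M^t*) h.
    by rewrite mulmx1 !adjmxM !trmxCK -!mulmxA.
  apply: adjmx_cancel; have := congr1 (fun M => M^t*) BGB.
  by rewrite mulmx1 !adjmxM trmxCK !mulmxA.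
have h : (A *m Z)^t* *m (A *m Z) = (A *m Z)^t*.
  by rewrite adjmxM -mulmxA (mulmxA _ A Z) AAZ.
exists Z => //; rewrite -[LHS]h; have := congr1 (fun M => M^t*) h.
by rewrite (adjmxM ((A *m Z)^t*)) trmxCK.
Qed.

Lemma pinv_ex m n (A : 'M[C]_(m, n)) : exists X, is_pinv A X.
Proof.
have [Z AZA AZh] := inv13_ex A; have [W AWA AWh] := inv13_ex (A^t*).
pose Y := W^t*.
have AYA : A *m Y *m A = A.
  by rewrite -[RHS]trmxCK -[in RHS]AWA !adjmxM trmxCK mulmxA.
have YAh : (Y *m A)^t* = Y *m A.
  by rewrite adjmxM /Y trmxCK -[LHS]AWh adjmxM trmxCK.
exists (Y *m A *m Z); apply/and4P; split; apply/eqP.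
- by rewrite !mulmxA AYA.
- rewrite -!mulmxA (mulmxA A Y) (mulmxA _ A Z) AYA.
  by rewrite (mulmxA A Z) (mulmxA _ A Z) AZA.
- by rewrite !mulmxA AYA.
- by rewrite -!mulmxA (mulmxA A Z) AZA.
Qed.

Definition pinv m n (A : 'M[C]_(m, n)) : 'M[C]_(n, m) := xchoose (pinv_ex A).

Lemma pinvP m n (A : 'M[C]_(m, n)) : is_pinv A (pinv A).
Proof. exact: xchooseP. Qed.

Lemma pinv_uniq m n (A : 'M[C]_(m, n)) X : is_pinv A X -> X = pinv A.
Proof.
have aux (Y Y' : 'M[C]_(n, m)) : is_pinv A Y -> is_pinv A Y' ->
    A *m Y = A *m Y' /\ Y *m A = Y' *m A.
  case/and4P => /eqP h1 /eqP h2 /eqP h3 /eqP h4.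
  case/and4P => /eqP k1 /eqP k2 /eqP k3 /eqP k4; split.
  - by rewrite -[LHS]h3 -[in LHS]k1 -[_ *m A *m Y]mulmxA adjmxM h3 k3 mulmxA h1.
  - have e : Y *m A *m (Y' *m A) = Y *m A by rewrite -mulmxA (mulmxA A) k1.
    by rewrite -[LHS]h4 -e adjmxM h4 k4 -mulmxA (mulmxA A) h1.
move=> hX; have [e1 e2] := aux _ _ hX (pinvP A).
have /and4P[_ /eqP X2 _ _] := hX; have /and4P[_ /eqP P2 _ _] := pinvP A.
by rewrite -X2 e2 -mulmxA e1 mulmxA P2.
Qed.

End MoorePenrose.

Section CoreEP.
Variables (C : numClosedFieldType) (n : nat).
Implicit Types A X Y : 'M[C]_n.

Definition is_core_ep A X : bool :=
  let k := mxindex A in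
  [&& X *m A *m X == X, same_colspace X (A ^+ k)
    & same_colspace (A ^+ k) (X^t*)].

Lemma core_ep_ex A : exists X, is_core_ep A X.
Proof.
have [AD _ ADk] := and3P (drazinP A).
move: AD ADk => /eqP + /eqP; move: (drazin A) => D AD ADk.
have [/eqP P1 _ /eqP P3 _] := and4P (pinvP (A ^+ mxindex A)).
have AS : A ^+ (mxindex A).+1 = A ^+ mxindex A *m A by exact: exprSr.
have DP : D *m A ^+ mxindex A = A ^+ mxindex A *m D.
  by apply/esym/commr_sym/commrX/commr_sym.
have AP : A *m A ^+ mxindex A = A ^+ mxindex A *m A by apply: commrX.
rewrite /is_core_ep; move: AS DP AP ADk P1 P3.
move: (A ^+ _.+1) (A ^+ mxindex A) (pinv _) => P' P G -> DP AP ADk P1 P3.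
have AX : A *m (D *m (P *m G)) = P *m G.
  by rewrite !mulmxA AD -(mulmxA D) AP ADk.
exists (D *m (P *m G)); apply/and3P; split.
- by rewrite -(mulmxA _ A) AX -!mulmxA (mulmxA P) (mulmxA _ P) P1.
- apply/same_colspaceP; split; first by exists (D *m G); rewrite !mulmxA DP.
  by exists (P *m A); rewrite -(mulmxA D) (mulmxA _ P) P1 ADk.
- apply/same_colspaceP; split.
    exists (A^t* *m P); rewrite mulmxA -(adjmxM A) AX P3.
    by rewrite P1.
  by exists (G *m D^t*); rewrite adjmxM P3 mulmxA.
Qed.

Definition core_ep A : 'M[C]_n := xchoose (core_ep_ex A).

Lemma core_epP A : is_core_ep A (core_ep A).
Proof. exact: xchooseP. Qed.

Lemma core_ep_uniq A X : is_core_ep A X -> X = core_ep A.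
Proof.
move: (core_epP A); move: (core_ep A) => Y.
have AP : A *m A ^+ mxindex A = A ^+ mxindex A *m A by apply: commrX.
rewrite /is_core_ep; move: (A ^+ _) AP => P AP.
have fixX X' : [&& X' *m A *m X' == X', same_colspace X' P
     & same_colspace P (X'^t*)] ->
   [/\ exists U, X' = P *m U, X' *m A *m P = P & P^t* *m (A *m X') = P^t*].
  case/and3P=> /eqP X1 /same_colspaceP[h1 [V dV]] /same_colspaceP[[W dW] h2].
  split=> //; first by rewrite dV mulmxA X1.
  by rewrite {1}dW adjmxM trmxCK -mulmxA (mulmxA X') X1 [in RHS]dW adjmxM trmxCK.
move=> /fixX[[U dU] _ PAY] /fixX[[U' dU'] XAP PAX].
have dXY : X - Y = P *m (U' - U) by rewrite mulmxBr -dU -dU'.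
have AXY : A *m (X - Y) = 0.
  have e : A *m (X - Y) = P *m (A *m (U' - U)).
    by rewrite dXY !mulmxA AP.
  have : P^t* *m (A *m (X - Y)) = 0 by rewrite !mulmxBr PAX PAY subrr.
  rewrite e => h; have := @adjmx_cancel _ _ _ _ P (A *m (U' - U)) 0.
  by rewrite -mulmxA h !mulmx0; apply.
apply/eqP; rewrite -subr_eq0; apply/eqP.
by rewrite dXY -[P]XAP -!mulmxA -dXY AXY mulmx0.
Qed.

Definition CEPD A : Prop := core_ep A *m drazin A = drazin A *m core_ep A.

End CoreEP.

(* Main.v *)
(* Put D = A^D, E = A D (the spectral projector onto the range of A^k) and
   Q = A^k (A^k)^+ (the orthogonal projector onto the same range).  Then
   A^cep = D Q, and equality of the ranges means E Q = Q and Q E = E.  With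
   these two relations each of the eight conditions reduces, after cancelling
   powers of A and D, to Q = E. *)
Require Import Defs.
From mathcomp Require Import all_boot all_order all_algebra.
From mathcomp Require Import reals complex.

Import GRing.Theory.
Local Open Scope ring_scope.
Local Open Scope complex_scope.

Section SameRangeProjector.
Variables (S : pzRingType) (a d q : S).
Hypotheses (ad : a * d = d * a) (dad : d * a * d = d).
Hypotheses (adq : a * d * q = q) (qad : q * (a * d) = a * d).

Lemma same_range_mulqd : q * d = d.
Proof. by rewrite -{1}dad -ad mulrA qad ad dad. Qed.

(** Since [q * d = d], each [q] is absorbed by the [d] on its right and only the last one
    survives. *)
Lemma same_range_exprM m : (d * q) ^+ m.+1 = d ^+ m.+1 * q.
Proof.
elim: m => [|m IHm]; first by rewrite !expr1.
by rewrite exprSr IHm mulrA -(mulrA (d ^+ _)) same_range_mulqd -exprSr.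
Qed.

Lemma drazin_projectorX m : a ^+ m.+1 * d ^+ m.+1 = a * d.
Proof.
rewrite -exprMn_comm; last exact: ad.
by elim: m => [|m IHm]; rewrite ?expr1 // exprS IHm -mulrA (mulrA d a d) dad.
Qed.

Lemma drazin_projectorXr m : d ^+ m.+1 * a ^+ m.+1 = a * d.
Proof.
rewrite -(drazin_projectorX m); apply: esym.
exact/commrX/commr_sym/commrX/commr_sym.
Qed.

(** Left multiplication by [a ^+ m.+1] turns [d ^+ m.+1] into the projector [a * d], which fixes
    [q]. *)
Lemma expr_drazin_cancel m : d ^+ m.+1 * q = d ^+ m.+1 -> q = a * d.
Proof.
by move/(congr1 ( *%R (a ^+ m.+1))); rewrite mulrA drazin_projectorX adq.
Qed.

Lemma expr_core_cancel m :
  a ^+ m.+1 * q = a ^+ m.+1 * (a * d) -> q = a * d.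
Proof.
move/(congr1 ( *%R (d ^+ m.+1))); rewrite !mulrA drazin_projectorXr adq => ->.
by rewrite -!mulrA (mulrA d a d) dad.
Qed.

(** A [pzRingType] may be the zero ring, so matrices of size 0 are covered. *)
Lemma same_range_tfae :
  [<-> d * q * d = d * (d * q);
       a * d * a * (d * q) = d * q * (a * d * a);
       d * (a * q) = a * q * d;
       a * d * a * (a * q) = a * q * (a * d * a);
       a ^+ 2 * q = a * (a * d * a);
       d * q = d;
       forall m, (2 <= m)%N -> (d * q) ^+ m = d ^+ m;
       exists m, (2 <= m)%N /\ (d * q) ^+ m = d ^+ m].
Proof.
have qd := same_range_mulqd.
have ada : a * d * a = a * (a * d) by rewrite [in RHS]ad mulrA.
(* By the equations below, the second and third conditions both say [q = a * d], the fourth and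
   fifth both [a ^+ 2 * q = a ^+ 2 * (a * d)]. *)
have e2 : a * (a * d * a) = a ^+ 2 * (a * d) by rewrite ada mulrA.
have e4 : a * q * (a * d * a) = a ^+ 2 * (a * d).
  by rewrite ada -(mulrA a q) -ada (mulrA q) qad ada mulrA.
have e4' : a * d * a * (a * q) = a ^+ 2 * q.
  by rewrite ada -(mulrA a) (mulrA (a * d)) ada -(mulrA a _ q) adq mulrA.
have e3 : d * (a * q) = q by rewrite mulrA -ad adq.
have e3' : a * q * d = a * d by rewrite -mulrA qd.
have e2l : a * d * a * (d * q) = q.
  by rewrite mulrA -(mulrA (a * d)) -mulrA adq adq.
have e2r : d * q * (a * d * a) = a * d.
  by rewrite mulrA -(mulrA d q) qad mulrA dad ad.
tfae.
(* As [q * d = d], the first condition reads [d * d = d * (d * q)]. *)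
- rewrite -mulrA qd => h; rewrite e2l e2r.
  by apply: (@expr_drazin_cancel 1); rewrite expr2 -mulrA -h.
- by rewrite e2l e2r e3 e3'.
- by rewrite e3 e3' e4 e4' => ->.
- by rewrite e4 e4' e2.
- by rewrite e2 => /expr_core_cancel ->; rewrite mulrA dad.
- by move=> -> m _.
- by move=> eX; exists 2%N; split=> //; exact: eX.
- case=> -[|m] [// _]; rewrite same_range_exprM => /expr_drazin_cancel qE.
  by rewrite -mulrA qd qE (mulrA d a) dad.
Qed.

End SameRangeProjector.

Section CoreEPDrazin.
Variables (C : numClosedFieldType) (n : nat) (A : 'M[C]_n).
Let P := A ^+ mxindex A.
Let D := drazin A.
Let Q := P *m pinv P.

Lemma drazin_comm : A *m drazin A = drazin A *m A.
Proof. by have /and3P[/eqP] := drazinP A. Qed.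

Lemma drazin_idem : drazin A *m A *m drazin A = drazin A.
Proof. by have /and3P[_ /eqP] := drazinP A. Qed.

Lemma drazin_projector_index : A *m D *m P = P.
Proof.
have /and3P[_ _ /eqP h] := drazinP A.
by rewrite drazin_comm -mulmxA -[RHS]h; congr mulmx; rewrite exprS.
Qed.

Lemma drazin_projector_pinv : A *m D *m Q = Q.
Proof. by rewrite mulmxA drazin_projector_index. Qed.

Lemma pinv_projector_drazin : Q *m (A *m D) = A *m D.
Proof.
have /and4P[/eqP PGP _ _ _] := pinvP P.
(* With k the index, A D = A^(k+1) D^(k+1) has [P] = A^k as a left factor, and [Q] fixes [P]. *)
have -> : A *m D = P *m (A *m D *m D ^+ mxindex A).
  rewrite -[LHS](drazin_projectorX _ A D drazin_comm drazin_idem (mxindex A)).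
  by rewrite exprSr exprS -mulrA -[A *m D *m _]mulmxA.
by rewrite mulmxA PGP.
Qed.

Lemma core_epE : core_ep A = D *m Q.
Proof.
have /and4P[/eqP P1 _ /eqP P3 _] := pinvP P.
have AX : A *m (D *m Q) = Q by rewrite mulmxA drazin_projector_pinv.
have QP : Q *m P = P by [].
have DP : D *m P = P *m D.
  by apply/esym/commr_sym/commrX/commr_sym/drazin_comm.
have AP : A *m P = P *m A by apply: commrX.
apply/esym/core_ep_uniq/and3P; split.
- by rewrite -(mulmxA _ A) AX /Q -mulmxA (mulmxA (P *m _)) P1.
- apply/same_colspaceP; split.
    by exists (D *m pinv P); rewrite !mulmxA DP.
  (* The witness comes from P = D A P = D (P A), with [Q] inserted because it fixes [P]. *)
  exists (P *m A); rewrite -mulmxA (mulmxA Q) QP -AP mulmxA -drazin_comm.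
  by rewrite drazin_projector_index.
(* [Q] is Hermitian: for X = D Q this gives X^* A^* = (A X)^* = Q and X^* = Q D^*, whence both
   inclusions. *)
- apply/same_colspaceP; split.
    by exists ((A ^t*)%sesqui *m P); rewrite mulmxA -adjmxM AX P3 QP.
  by exists (pinv P *m (D ^t*)%sesqui); rewrite adjmxM P3 mulmxA.
Qed.

End CoreEPDrazin.

Theorem theorem3p2 (R : realType) (n : nat) (A : 'M[R[i]]_n) (k : nat)
    (hk : mxindex A = k) :
  [<-> (* (i) *)    CEPD A;
       (* (ii) *)   core_part A *m core_ep A = core_ep A *m core_part A;
       (* (iii) *)  drazin A *m A ^+ (k + 1) *m pinv (A ^+ k)
                    = A ^+ (k + 1) *m pinv (A ^+ k) *m drazin A;
       (* (iv) *)   core_part A *m A ^+ (k + 1) *m pinv (A ^+ k)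
                    = A ^+ (k + 1) *m pinv (A ^+ k) *m core_part A;
       (* (v) *)    A ^+ (k + 2) *m pinv (A ^+ k) = A *m core_part A;
       (* (vi) *)   core_ep A = drazin A;
       (* (vii) *)  forall m : nat, (2 <= m)%N ->
                    core_ep A ^+ m = drazin A ^+ m;
       (* (viii) *) exists m : nat, (2 <= m)%N /\
                    core_ep A ^+ m = drazin A ^+ m].
Proof.
rewrite -hk /CEPD core_epE.
(* Splitting powers of A off on the left of A^k exposes [Q] = A^k (A^k)^+, so the conditions match
   the ring statement. *)
rewrite -!(mulmxA _ (A ^+ (_ + 1))) !(addnC (mxindex A)) !powerD expr1.
rewrite -!(mulmxA _ (A ^+ mxindex A)).
exact: same_range_tfae _ _ _ _ (drazin_comm _ _ A) (drazin_idem _ _ A)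
  (drazin_projector_pinv _ _ A) (pinv_projector_drazin _ _ A).
Qed.
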